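(* For $\sigma\in\{231,312\}$, let $f_n^2(\sigma)$ be the number of permutations $\pi\in\mathcal{S}_n$ that avoid $\sigma$ and satisfy $\theta^2(\pi)=\pi$ (with $f_0^2(\sigma)=1$). Then $$\sum_{n\geq 0} f_n^2(\sigma)x^n=\frac{1}{1-x-x^2-x^4}.$$
   Context: $\mathcal{S}_n$ is the symmetric group on $[n]$, permutations in one-line notation $\pi_1\cdots\pi_n$. A permutation avoids a pattern $\tau$ if it has no subsequence order-isomorphic to $\tau$. The standard cycle notation of $\pi$ writes each cycle (fixed points included) with its largest element first and orders cycles by increasing largest element. The fundamental bijection $\theta:\mathcal{S}_n\to\mathcal{S}_n$ maps $\pi$ to the permutation whose one-line notation is obtained by erasing the parentheses of the standard cycle notation of $\pi$; $\theta^2=\theta\circ\theta$. *)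

(* Defs.v *)
From HB Require Import structures.
From mathcomp Require Import all_boot all_order all_fingroup all_algebra.

Set Implicit Arguments.
Unset Strict Implicit.
Unset Printing Implicit Defensive.

Import GRing.Theory.

(* S_n is 'S_n, permuting {0, ..., n-1}; [one_line] shifts values by one so
   that words are over [n] = {1, ..., n}. *)
Definition one_line n (s : 'S_n) : seq nat :=
  [seq (val (s i)).+1 | i <- enum 'I_n].

Definition order_iso (u v : seq nat) : bool :=
  (size u == size v) &&
  [forall i : 'I_(size u), forall j : 'I_(size u),
     (nth 0 u i < nth 0 u j) == (nth 0 v i < nth 0 v j)].

(* [mask m w], for a bit-vector m, ranges over the subsequences of w;
   see [containsP]. *)
Definition contains (w tau : seq nat) : bool :=
  [exists m : (size w).-tuple bool, order_iso (mask m w) tau].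

Definition avoids n (s : 'S_n) (tau : seq nat) : bool :=
  ~~ contains (one_line s) tau.

Lemma containsP w tau :
  reflect (exists2 u, subseq u w & order_iso u tau) (contains w tau).
Proof.
apply: (iffP existsP) => [[m Hm]|[u /subseqP [m /eqP sz_m ->] Hu]].
  by exists (mask m w) => //; apply: mask_subseq.
by exists (Tuple sz_m).
Qed.

Section Fundamental.

Variables (n : nat) (s : 'S_n).

Definition is_cycle_max (m : 'I_n) : bool :=
  [forall y in porbit s m, y <= m].

(* The cycles (m, s m, s (s m), ...), each starting with its largest element
   m, listed by increasing m since [enum 'I_n] is increasing. *)
Definition std_cycles : seq (seq 'I_n) :=
  [seq traject s m #|porbit s m| | m <- enum 'I_n & is_cycle_max m].

Definition theta_word : seq 'I_n := flatten std_cycles.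

Lemma theta_word_uniq : uniq theta_word.
Proof.
rewrite /theta_word /std_cycles.
have: uniq [seq m <- enum 'I_n | is_cycle_max m].
  by rewrite filter_uniq ?enum_uniq.
have: all is_cycle_max [seq m <- enum 'I_n | is_cycle_max m].
  exact: filter_all.
elim: [seq _ <- _ | _] => //= m ms IH /andP[max_m max_ms] /andP[m_ms uniq_ms].
rewrite cat_uniq uniq_traject_porbit IH // andbT /=.
apply/hasPn => x /flattenP[_ /mapP[m' m'_ms ->]].
rewrite -!porbit_traject => x_m'; apply: contra m_ms => x_m.
have eq_o : porbit s m = porbit s m'.
  by move: x_m x_m'; rewrite -!eq_porbit_mem => /eqP <- /eqP.
have /forall_inP max_m' := allP max_ms _ m'_ms.
have -> // : m = m'.
apply/val_inj/eqP; rewrite eqn_leq (forall_inP max_m) ?eq_o ?porbit_id //.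
by rewrite max_m' // -eq_o porbit_id.
Qed.

Lemma size_theta_word : size theta_word = n.
Proof.
rewrite -{2}(card_ord n) -(card_uniqP theta_word_uniq).
apply: eq_card => x; rewrite inE; apply/flattenP.
have x_in := porbit_id s x.
case: (arg_maxnP val x_in) => m m_x max_m.
have eq_o : porbit s x = porbit s m by apply/eqP; rewrite eq_sym eq_porbit_mem.
exists (traject s m #|porbit s m|).
  apply: map_f; rewrite mem_filter mem_enum andbT.
  by apply/forall_inP => y; rewrite -eq_o => /max_m.
by rewrite -porbit_traject -eq_o.
Qed.

Lemma theta_inj : injective (fun i : 'I_n => nth i theta_word i).
Proof.
move=> i j /= /eqP; rewrite (set_nth_default i j) ?size_theta_word //.
by rewrite nth_uniq ?theta_word_uniq ?size_theta_word // => /eqP/val_inj.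
Qed.

Definition theta : 'S_n := perm theta_inj.

Lemma one_line_theta : one_line theta = [seq (val i).+1 | i <- theta_word].
Proof.
rewrite /one_line; case: (posnP n) => [n0|n_gt0].
  have /size0nil -> : size (enum 'I_n) = 0 by rewrite size_enum_ord.
  by have /size0nil -> : size theta_word = 0 by rewrite size_theta_word.
pose i0 := Ordinal n_gt0.
apply: (@eq_from_nth _ 0) => [|i]; rewrite size_map size_enum_ord.
  by rewrite size_map size_theta_word.
move=> lt_in; rewrite (nth_map i0) ?size_enum_ord //.
rewrite [RHS](nth_map i0) ?size_theta_word //.
rewrite permE; have -> : nth i0 (enum 'I_n) i = Ordinal lt_in.
  by apply: val_inj; rewrite /= nth_enum_ord.
by congr (val _).+1; apply: set_nth_default; rewrite size_theta_word.
Qed.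

End Fundamental.

Definition f2 (n : nat) (sigma : seq nat) : nat :=
  #|[set s : 'S_n | avoids s sigma & theta (theta s) == s]|.

Local Open Scope ring_scope.

(* The formal power series with n-th coefficient [a n]; equality of series is
   pointwise equality [=1]. *)
Definition fps (R : Type) := nat -> R.

Definition fps_one (R : nzRingType) : fps R := fun n => (n == 0%N)%:R.

Definition fps_mul (R : nzRingType) (a b : fps R) : fps R :=
  fun n => \sum_(i < n.+1) a i * b (n - i)%N.

Definition fps_of_poly (R : nzRingType) (p : {poly R}) : fps R := fun n => p`_n.

(* b_n = a_0^-1 (delta_(n,0) - sum_(1 <= k <= n) a_k b_(n-k)); characterized
   as the multiplicative inverse by [fps_mulV] and [fps_inv_uniq]. *)
Fixpoint fps_inv_coefs (R : unitRingType) (a : fps R) (n : nat) : seq R :=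
  if n is m.+1 then
    let b := fps_inv_coefs a m in
    rcons b ((a 0%N)^-1 * ((m == 0%N)%:R - \sum_(i < m) a i.+1 * b`_(m - i.+1)))
  else [::].

Definition fps_inv (R : unitRingType) (a : fps R) : fps R :=
  fun n => (fps_inv_coefs a n.+1)`_n.

Definition fps_div (R : unitRingType) (a b : fps R) : fps R :=
  fps_mul a (fps_inv b).

Lemma size_fps_inv_coefs (R : unitRingType) (a : fps R) n :
  size (fps_inv_coefs a n) = n.
Proof. by elim: n => //= n IHn; rewrite size_rcons IHn. Qed.

Lemma nth_fps_inv_coefs (R : unitRingType) (a : fps R) n i :
  (i < n)%N -> (fps_inv_coefs a n)`_i = fps_inv a i.
Proof.
elim: n => // n IHn; rewrite ltnS leq_eqVlt => /predU1P[-> //|lt_in].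
by rewrite /= nth_rcons size_fps_inv_coefs lt_in IHn.
Qed.

Lemma fps_invE (R : unitRingType) (a : fps R) n :
  fps_inv a n =
  (a 0%N)^-1 * ((n == 0%N)%:R - \sum_(i < n) a i.+1 * fps_inv a (n - i.+1)%N).
Proof.
rewrite {1}/fps_inv /= nth_rcons size_fps_inv_coefs ltnn eqxx.
congr (_ * (_ - _)); apply: eq_bigr => i _.
by rewrite nth_fps_inv_coefs // ltn_subrL (leq_ltn_trans _ (ltn_ord i)).
Qed.

Lemma fps_mulV (R : unitRingType) (a : fps R) :
  a 0%N \is a GRing.unit -> fps_mul a (fps_inv a) =1 fps_one R.
Proof.
move=> a0 n; rewrite /fps_mul big_ord_recl /= subn0 fps_invE mulVKr //.
by rewrite subrK.
Qed.

Lemma fps_inv_uniq (R : unitRingType) (a b : fps R) :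
  a 0%N \is a GRing.unit -> fps_mul a b =1 fps_one R -> b =1 fps_inv a.
Proof.
move=> a0 ab n; elim/ltn_ind: n => n IHn.
rewrite fps_invE; apply: (mulrI a0); rewrite mulVKr //.
have := ab n; rewrite /fps_mul big_ord_recl subn0 /fps_one => <-.
rewrite [X in _ - X](eq_bigr (fun i : 'I_n => a i.+1 * b (n - i.+1)%N)).
  by rewrite addrK.
move=> i _; rewrite IHn // ltn_subrL (leq_ltn_trans _ (ltn_ord i)) //.
Qed.

(* Main.v *)
Require Import Defs.
From mathcomp Require Import all_boot all_order all_fingroup all_algebra.
From mathcomp Require Import zify ring.
Set Implicit Arguments.
Unset Strict Implicit.
Unset Printing Implicit Defensive.

(** The one-line word of [theta s] determines [s]: the image of a letter is the
    next letter, unless that letter is a left-to-right maximum, in which case it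
    is the maximum read so far.  Extending permutations of [{0, ..., n-1}] by the
    identity to all of [nat], this reads [s (t i) = min (t (i+1)) (max_(j <= i) t j)]
    with [t = theta s], and it respects direct sums.  So the permutations with
    [theta (theta s) = s] are exactly the direct sums of indecomposable ones, and
    it remains to find the latter.  Playing the equations for [(s, t)] and [(t, s)]
    against each other near the largest value, together with pattern avoidance,
    leaves only the blocks [1], [21] and one block of size 4, namely [4132] for
    231 and [3421] for 312 (these two are exchanged by [theta]).  Hence
    [f_n = f_(n-1) + f_(n-2) + f_(n-4)]. *)

(** * Prefix maxima, permutations of [nat], and [theta] as a relation *)

Fixpoint pmax (g : nat -> nat) (i : nat) : nat :=
  if i is j.+1 then maxn (pmax g j) (g i) else g 0.

Lemma leq_pmax g i j : j <= i -> g j <= pmax g i.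
Proof.
elim: i => [|i IHi]; first by rewrite leqn0 => /eqP->.
by rewrite leq_eqVlt leq_max => /predU1P[->|/IHi->//]; rewrite leqnn orbT.
Qed.

Lemma pmax_attained g i : exists2 j, j <= i & pmax g i = g j.
Proof.
elim: i => [|i [j le_ji e]]; first by exists 0.
rewrite /=; case: (leqP (pmax g i) (g i.+1)) => _; first by exists i.+1.
by exists j => //; lia.
Qed.

Lemma eq_pmax g h i : (forall j, j <= i -> g j = h j) -> pmax g i = pmax h i.
Proof.
elim: i => [|i IHi] gh /=; first exact: gh.
by rewrite IHi ?gh // => j le_ji; apply: gh; lia.
Qed.

(* A permutation of [{0, ..., n-1}], extended by the identity. *)
Definition nat_perm (n : nat) (f : nat -> nat) : Prop :=
  injective f /\ forall i, n <= i -> f i = i.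

(* [g = theta f], see [thetaP]. *)
Definition theta_rel (f g : nat -> nat) : Prop :=
  forall i, f (g i) = minn (g i.+1) (pmax g i).

Section NatPerm.
Variables (n : nat) (f : nat -> nat).
Hypothesis fP : nat_perm n f.

Lemma nat_perm_eq i j : f i = f j -> i = j.
Proof. by case: fP => finj _ /finj. Qed.

Lemma nat_perm_ltn i : i < n -> f i < n.
Proof.
case: fP => finj fid lt_in; rewrite ltnNge; apply/negP => le_nf.
by move/fid/finj: (le_nf); lia.
Qed.

Lemma nat_perm_surj y : y < n -> exists2 i, i < n & f i = y.
Proof.
move=> lt_yn; have [finj _] := fP.
have sub : {subset mkseq f n <= iota 0 n}.
  move=> z /mapP[i]; rewrite !mem_iota => lt_in ->.
  by have := @nat_perm_ltn i; lia.
have [|_ eq_mem] := uniq_min_size (mkseq_uniq n finj) sub.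
  by rewrite size_mkseq size_iota.
have: y \in mkseq f n by rewrite eq_mem mem_iota; lia.
by case/mapP => i; rewrite mem_iota => lt_in ->; exists i; lia.
Qed.

Lemma pmax_ltn i : i < n -> pmax f i < n.
Proof.
by have [j le_ji ->] := pmax_attained f i => lt_in; apply: nat_perm_ltn; lia.
Qed.

Lemma pmax_after_max j i : f j = n.-1 -> j <= i < n -> pmax f i = n.-1.
Proof.
move=> fj /andP[le_ji lt_in].
by have := leq_pmax f le_ji; have := pmax_ltn lt_in; lia.
Qed.

End NatPerm.

(** Both sides equal [i], so [theta_rel] only has to be checked below [n]. *)
Lemma theta_rel_geq n f g i : nat_perm n f -> nat_perm n g -> n <= i ->
  f (g i) = minn (g i.+1) (pmax g i).
Proof.
move=> fP gP le_ni.
have := leq_pmax g (leqnn i); have [j le_ji ->] := pmax_attained g i.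
have := @nat_perm_ltn _ _ gP j; case: fP => _ fid; case: gP => _ gid.
by rewrite (gid i) ?(gid i.+1) ?fid; try lia; case: (ltnP j n) => [|/gid->]; lia.
Qed.

(** * Direct sums and stable prefixes *)

Definition dsum (k : nat) (f b : nat -> nat) (i : nat) : nat :=
  if i < k then f i else k + b (i - k).

Lemma dsum_lt k f b i : i < k -> dsum k f b i = f i.
Proof. by rewrite /dsum => ->. Qed.

Lemma dsum_add k f b i : dsum k f b (k + i) = k + b i.
Proof. by rewrite /dsum ltnNge leq_addr /= addKn. Qed.

Lemma nat_perm_dsum k m f b :
  nat_perm k f -> nat_perm m b -> nat_perm (k + m) (dsum k f b).
Proof.
move=> fP bP; split=> [i j|i le_i]; rewrite /dsum.
  have := @nat_perm_ltn _ _ fP i; have := @nat_perm_ltn _ _ fP j.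
  case: (ltnP i k) => ik; case: (ltnP j k) => jk; try lia.
    by move=> _ _; apply: (nat_perm_eq fP).
  move=> _ _ e; have := @nat_perm_eq _ _ bP (i - k) (j - k); lia.
have -> : i < k = false by lia.
by case: bP => _ ->; lia.
Qed.

Lemma pmax_dsum_lt k f b i : i < k -> pmax (dsum k f b) i = pmax f i.
Proof. by move=> lt_ik; apply: eq_pmax => j le_ji; rewrite dsum_lt //; lia. Qed.

Lemma pmax_dsum_add k f b i :
  nat_perm k f -> pmax (dsum k f b) (k + i) = k + pmax b i.
Proof.
move=> fP; elim: i => [|i IHi]; last first.
  by rewrite addnS /= IHi -addnS dsum_add; lia.
rewrite addn0; case: k fP => [|k] fP; first by rewrite /= /dsum ltnn.
have -> : pmax (dsum k.+1 f b) k.+1 = maxn (pmax f k) (k.+1 + b 0).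
  by rewrite /= pmax_dsum_lt // /dsum ltnn subnn.
by have := pmax_ltn fP (leqnn k.+1); rewrite /=; lia.
Qed.

(** Letters of the second summand exceed all earlier ones, so its prefix maxima ignore the first
    summand. At the seam [i.+1 = k] the next letter is at least [k], whether it comes from [c] or is
    the fixed point of [g], and the minimum is the prefix maximum either way. *)
Lemma theta_rel_dsum k f g b c :
  nat_perm k f -> nat_perm k g ->
  theta_rel (dsum k f b) (dsum k g c) <-> theta_rel f g /\ theta_rel b c.
Proof.
move=> fP gP.
have low i : i < k -> dsum k f b (dsum k g c i) = f (g i) /\
    minn (dsum k g c i.+1) (pmax (dsum k g c) i) = minn (g i.+1) (pmax g i).
  move=> lt_ik; rewrite (dsum_lt _ _ lt_ik) dsum_lt; last exact: nat_perm_ltn gP _ lt_ik.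
  split=> //; rewrite pmax_dsum_lt //; have lt_p := pmax_ltn gP lt_ik.
  case: (ltnP i.+1 k) => [lt_i1|le_k]; first by rewrite dsum_lt.
  by rewrite /dsum ltnNge le_k /=; case: gP => _ ->; lia.
have high i : dsum k f b (dsum k g c (k + i)) = k + b (c i) /\
    minn (dsum k g c (k + i).+1) (pmax (dsum k g c) (k + i))
      = k + minn (c i.+1) (pmax c i).
  by rewrite -addnS !dsum_add pmax_dsum_add // addn_minr.
split=> [fg|[fg bc] i].
  split=> i; last by have := fg (k + i); have [-> ->] := high i; lia.
  case: (ltnP i k) => [lt_ik|le_ki].
    by have := fg i; have [-> ->] := low i lt_ik.
  exact: theta_rel_geq fP gP _.
case: (ltnP i k) => [lt_ik|le_ki].
  by have [-> ->] := low i lt_ik.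
by rewrite -(subnKC le_ki); have [-> ->] := high (i - k); rewrite bc.
Qed.

Lemma nat_perm_restrict n k f : nat_perm n f -> (forall i, i < k -> f i < k) ->
  nat_perm k (fun i => if i < k then f i else i).
Proof.
move=> fP fk; split=> [i j|i le_ki]; last by rewrite ltnNge le_ki.
have := fk i; have := fk j; case: (ltnP i k) => ?; case: (ltnP j k) => ?; try lia.
by move=> _ _; apply: (nat_perm_eq fP).
Qed.

Lemma stable_geq n k f : nat_perm n f -> (forall i, i < k -> f i < k) ->
  forall i, k <= i -> k <= f i.
Proof.
move=> fP fk i le_ki; rewrite leqNgt; apply/negP.
case/(nat_perm_surj (nat_perm_restrict fP fk)) => j lt_jk.
by rewrite lt_jk => /(nat_perm_eq fP); lia.
Qed.

(* Values [>= k] persist along the word of [g], so they form its tail. *)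
Lemma theta_rel_stable n k f g : nat_perm n f -> nat_perm n g -> k <= n ->
  (forall i, i < k -> f i < k) -> theta_rel f g -> forall i, i < k -> g i < k.
Proof.
move=> fP gP le_kn fk fg i lt_ik; rewrite ltnNge; apply/negP => le_kg.
(* The next letter of [g] is at least [f (g (i + j))], which is at least [k] by stability. So the
   [n - i] letters from position [i] on would all be among [n - k] values, although [i < k]. *)
have gge j : k <= g (i + j).
  elim: j => [|j IHj]; first by rewrite addn0.
  by have := fg (i + j); have := stable_geq fP fk IHj; rewrite addnS; lia.
have uniq_g : uniq (map g (iota i (n - i))).
  by rewrite map_inj_uniq ?iota_uniq //; case: gP.
have sub : {subset map g (iota i (n - i)) <= iota k (n - k)}.
  move=> z /mapP[j]; rewrite !mem_iota => lt_j ->.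
  have := gge (j - i); rewrite subnKC; last by lia.
  by have := @nat_perm_ltn _ _ gP j; lia.
by have := uniq_leq_size uniq_g sub; rewrite size_map !size_iota; lia.
Qed.

Lemma dsum_split n k f : nat_perm n f -> k <= n -> (forall i, i < k -> f i < k) ->
  exists f1 b, [/\ nat_perm k f1, nat_perm (n - k) b & f =1 dsum k f1 b].
Proof.
move=> fP le_kn fk; have fge := stable_geq fP fk.
exists (fun i => if i < k then f i else i), (fun i => f (k + i) - k).
split=> [||i]; first exact: nat_perm_restrict fP fk.
  split=> [i j e|i le_i]; last by case: fP => _ ->; lia.
  have := fge (k + i); have := fge (k + j).
  by have := @nat_perm_eq _ _ fP (k + i) (k + j); lia.
rewrite /dsum; case: ltnP => // le_ki; rewrite (subnKC le_ki).
by have := fge i le_ki; lia.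
Qed.

(** * Indecomposable blocks avoiding 231 or 312 *)

Definition bad231 x y z := z < x < y.
Definition bad312 x y z := y < z < x.

Definition avoidf (bad : nat -> nat -> nat -> bool) (f : nat -> nat) : Prop :=
  forall i j k, i < j < k -> ~~ bad (f i) (f j) (f k).

Definition indecomposable (n : nat) (f : nat -> nat) : Prop :=
  forall k, 0 < k < n -> ~ (forall i, i < k -> f i < k).

(** The default value [i] extends the word by the identity. *)
Definition block (s : seq nat) (i : nat) : nat := nth i s i.

Lemma theta_rel_max N f g : nat_perm N.+1 f -> nat_perm N.+1 g ->
  theta_rel f g -> f (g N) = N.
Proof.
move=> fP gP fg; rewrite fg; case: (gP) => _ ->; last by lia.
have [j lt_j gj] := nat_perm_surj gP (ltnSn N).
by have /(_ j N) := pmax_after_max gP; rewrite gj /= => ->; lia.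
Qed.

(** If [N] stood at a position [j > 0], some [i < j] would have [f i >= j]. Avoiding 231 with [N] in
    the middle, the [N - j] letters after [N] all lie strictly between [f i] and [N], which is too
    few values. *)
Lemma avoid231_indec_max0 N f : nat_perm N.+1 f -> avoidf bad231 f ->
  indecomposable N.+1 f -> f 0 = N.
Proof.
move=> fP av ind; have [j lt_j fj] := nat_perm_surj fP (ltnSn N).
case: (posnP j) => [<- //|j_gt0]; case: (ind j); first by lia.
move=> i lt_ij; rewrite ltnNge; apply/negP => le_j.
have uniq_f : uniq (map f (iota j.+1 (N - j))).
  by rewrite map_inj_uniq ?iota_uniq //; case: fP.
have sub : {subset map f (iota j.+1 (N - j)) <= iota (f i).+1 (N - (f i).+1)}.
  move=> z /mapP[k]; rewrite !mem_iota => lt_k ->.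
  have := av i j k; rewrite /bad231 fj.
  have := @nat_perm_ltn _ _ fP i; have := @nat_perm_ltn _ _ fP k.
  have := @nat_perm_eq _ _ fP i j; have := @nat_perm_eq _ _ fP k j.
  by have := @nat_perm_eq _ _ fP i k; lia.
have := uniq_leq_size uniq_f sub; rewrite size_map !size_iota.
have := @nat_perm_ltn _ _ fP i.
by have := @nat_perm_eq _ _ fP i j; lia.
Qed.

(** Since [f 0 = N], all prefix maxima of [f] below [N.+1] are [N], so the word of [f] is the orbit
    of [N] under [g], and [g] is a single cycle on these values. The equations [theta_rel f g] then
    determine the first letters of [f]. *)
Lemma indecomposable231 N f g : nat_perm N.+1 f -> nat_perm N.+1 g ->
  theta_rel f g -> theta_rel g f -> avoidf bad231 f -> indecomposable N.+1 f ->
  [\/ mkseq f N.+1 = [:: 0], mkseq f N.+1 = [:: 1; 0]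
    | mkseq f N.+1 = [:: 3; 0; 2; 1]].
Proof.
move=> fP gP fg gf av ind; have f0 := avoid231_indec_max0 fP av ind.
have gN : g N = 0.
  by apply: (nat_perm_eq fP); rewrite f0 (theta_rel_max fP gP).
have fid i : N < i -> f i = i by case: fP => _; apply.
have fle i : i <= N -> f i <= N by move=> le_i; apply: (nat_perm_ltn fP).
have step i : i < N -> g (f i) = f i.+1.
  move=> lt_iN; rewrite gf (@pmax_after_max _ _ fP 0) //=; last by lia.
  by have := fle i.+1; lia.
have gfN : g (f N) = N.
  by rewrite gf (fid N.+1) // (@pmax_after_max _ _ fP 0) //=; lia.
case: N => [|[|[|N]]] in fP gP ind f0 gN fid fle fg gf step gfN *.
- by constructor 1; rewrite /mkseq /= f0.
- constructor 2; rewrite /mkseq /= f0; congr [:: _; _].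
  by rewrite -[f 1]step // f0 gN.
- have f1 : f 1 = 0 by rewrite -step // f0 gN.
  have f2 : f 2 = 1.
    have := fle 2; have := @nat_perm_eq _ _ fP 2 0; have := @nat_perm_eq _ _ fP 2 1.
    by rewrite f0 f1; lia.
  (* Size 3 is impossible: [g 1 = 2] gives [f (g 1) = 1], but the equation at 1 gives 0 because
     [g 2 = 0]. *)
  have := fg 1; have := step 1; rewrite f1 f2 gN.
  by move: gfN; rewrite f2 => ->; rewrite f2; lia.
set M := N.+2 in fP gP ind f0 gN fid fle fg gf step gfN *.
have f1 : f 1 = 0 by rewrite -step // f0 gN.
have gM : g M = 1.
  by apply: (nat_perm_eq fP); rewrite fg gN f1; lia.
have [i lt_i fi] := nat_perm_surj fP (leqW (ltnSn M)).
have lt_iM : i < M.+1.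
  rewrite ltn_neqAle; apply/andP; split; last by lia.
  by apply/eqP => e; move: gfN; rewrite -e fi gM; lia.
have fi1 : f i.+1 = 1 by rewrite -step // fi gM.
(* If [2 < i], positions [2], [i], [i.+1] carry a value strictly between 1 and [M], then [M], then
   1: a 231. *)
have i2 : i = 2.
  case: i => [|[|[|i]]] in lt_i fi lt_iM fi1 *; rewrite ?f0 ?f1 in fi * => //; try lia.
  have := av 2 i.+3 i.+4; rewrite /bad231 fi fi1.
  have := @nat_perm_eq _ _ fP 2 1; have := @nat_perm_eq _ _ fP 2 i.+4.
  have := @nat_perm_eq _ _ fP 2 0; have := @nat_perm_eq _ _ fP 2 i.+3; have := fle 2.
  by rewrite f0 f1 fi fi1; lia.
move: fi fi1; rewrite {i}i2 in lt_i lt_iM * => f2 f3.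
case: (posnP N) => [N0|N_gt0].
  by constructor 3; rewrite /M N0 /mkseq /= f0 f1 f2 f3 /M N0.
have g0 : g 0 = M by rewrite -f1 step // f2.
have g1 : g 1 = f 4 by have := step 3; rewrite f3; apply; lia.
have f4 : f 4 < M.
  have := @nat_perm_eq _ _ fP 4 0; have := @nat_perm_eq _ _ fP 4 2.
  by have := fle 4; rewrite f0 f2 /M; lia.
(* The equation at 0 reads [f M = minn (g 1) (g 0)], and [g 1 = f 4 < M = g 0]. *)
have M4 : M = 4.
  by apply: (nat_perm_eq fP); rewrite -{1}g0 fg /= g0 g1; lia.
(* A fixed point of [g] is incompatible with its being a single cycle; the cases on the position of
   3 below spell this out. *)
have gM1 : g 3 = 3.
  apply: (nat_perm_eq fP); rewrite fg f3 -M4 gM.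
  by have := leq_pmax g (leq0n 3); rewrite g0; lia.
have [k lt_k fk] : exists2 i, i < M.+2 & f i = 3.
  by apply: (nat_perm_surj fP); lia.
rewrite M4 in lt_k f0 f2 gfN step.
case: k => [|[|[|[|[|[|k]]]]]] in lt_k fk *; try lia.
  by have := step 4 isT; rewrite fk gM1 => f5; have := @nat_perm_eq _ _ fP 4 5; lia.
by move: gfN; rewrite fk gM1.
Qed.

(** Let [j] be the position of [N] in [f]. The equations [theta_rel f g] yield the last letters of
    [g] from right to left, and [theta_rel g f] turns each of them into information on the letter of
    [f] following [N], [N.-1], [N.-2]. *)
Lemma indecomposable312 N f g : nat_perm N.+1 f -> nat_perm N.+1 g ->
  theta_rel f g -> theta_rel g f -> avoidf bad312 f -> indecomposable N.+1 f ->
  [\/ mkseq f N.+1 = [:: 0], mkseq f N.+1 = [:: 1; 0]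
    | mkseq f N.+1 = [:: 2; 3; 1; 0]].
Proof.
move=> fP gP fg gf av ind; have fgN := theta_rel_max fP gP fg.
have inj i j : f i = f j -> i = j by apply: (nat_perm_eq fP).
have fle i : i <= N -> f i <= N by move=> le_i; apply: (nat_perm_ltn fP).
have [j lt_j fj] := nat_perm_surj fP (ltnSn N).
have gN : g N = j by apply: inj; rewrite fgN.
case: (ltnP j N) => [lt_jN|le_Nj]; last first.
  have jN : j = N by lia.
  case: N => [|N] in fP gP ind fg gf fgN fle lt_j fj gN le_Nj jN *.
    by constructor 1; rewrite /mkseq /= -{1}jN fj.
  case: (ind N.+1); first by lia.
  by move=> i lt_i; have := fle i; have := inj i j; lia.
(* As [g N = j < N], the value [N] occurs in [g] before position [N]; once it has occurred, the
   minimum in [theta_rel f g] is the next letter. *)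
have pmaxg i : i < N -> N <= pmax g i \/ exists2 k, i < k < N & g k = N.
  move=> lt_i; have [k lt_k gk] := nat_perm_surj gP (ltnSn N).
  case: (leqP k i) => [le_ki|lt_ik]; first by left; rewrite -gk leq_pmax.
  right; exists k => //; case: (eqVneq k N) => [e|]; last by lia.
  by move: gk; rewrite e gN; lia.
have fj1 : f j.+1 = j.
  have := gf j; rewrite fj gN (@pmax_after_max _ _ fP j) //=; last by lia.
  by have := fle j.+1; lia.
have gN1 : g N.-1 = j.+1.
  apply: inj; rewrite fg prednK ?gN ?fj1; last by lia.
  by have [] := pmaxg N.-1; [lia|lia|case; lia].
(* If [N = j.+1], then [f] ends with the block 21, and indecomposability forces [j = 0]. *)
case: (ltnP j.+1 N) => [lt_j1|le_j1]; last first.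
  have Nj : N = j.+1 by lia.
  rewrite Nj in fP gP ind fg gf fle lt_j fj lt_jN *.
  case: j => [|j] in fP gP ind fg gf fle lt_j fj fj1 lt_jN gN gN1 le_j1 Nj *.
    by constructor 2; rewrite /mkseq /= fj fj1.
  case: (ind j.+1); first by lia.
  by move=> i lt_i; have := fle i; have := inj i j.+1; have := inj i j.+2; lia.
have [i0 lt_i0 fi0] : exists2 i, i < N.+1 & f i = N.-1.
  by apply: (nat_perm_surj fP); lia.
(* Otherwise [N], [j], [N.-1] at positions [j], [j.+1], [i0] form a 312. *)
have lt_i0j : i0 < j.
  have := av j j.+1 i0; rewrite /bad312 fj fj1 fi0.
  have ne0 : i0 <> j by move=> e; move: fi0; rewrite e fj; lia.
  by have ne1 : i0 <> j.+1 by [move=> e; move: fi0; rewrite e fj1; lia]; lia.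
have pm0 : N.-1 <= pmax f i0 by rewrite -fi0 leq_pmax.
have gf0 := gf i0; rewrite fi0 gN1 in gf0.
have pm1 : pmax f i0 < N.
  have [k le_k ->] := pmax_attained f i0.
  by have := fle k; have := inj k j; lia.
(* The equation at [i0] reads [j.+1 = minn (f i0.+1) N.-1]. If the minimum is not the first
   argument, the block of size 4 results; the other case is contradictory. *)
case: (eqVneq (f i0.+1) j.+1) => [fi1|ne_fi1]; last first.
  have Nj : N = j.+2 by lia.
  have ji : j = i0.+1.
    by have := fle i0.+1; have := inj i0.+1 i0; have := inj j i0.+1; lia.
  have gN2 : g j = i0.
    have e1 : j.+1 = N.-1 by lia.
    apply: inj; rewrite fg fi0 {1}e1 gN1.
    have [] := pmaxg j; [lia|lia|case=> k lt_k gk].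
    have kN : k = N.-1 by lia.
    by move: gk; rewrite kN gN1; lia.
  have fN : f N = i0.
    have := gf j.+1; rewrite fj1 gN2 (@pmax_after_max _ _ fP j) //=; last by lia.
    by have := fle N; rewrite Nj; lia.
  (* Positions [i0] to [N] carry [i0 + 2], [i0 + 3], [i0 + 1], [i0], so the first [i0] positions are
     stable and [i0 = 0]. *)
  rewrite ji in Nj fj fj1.
  case: i0 => [|i] in lt_i0 fi0 lt_i0j pm0 pm1 gf0 ne_fi1 ji gN2 fN Nj fj fj1 *.
    by constructor 3; rewrite Nj /mkseq /= fi0 fj fj1; move: fN; rewrite Nj => ->.
  case: (ind i.+1); first by lia.
  move=> k lt_k; have := fle k; have := inj k i.+1; have := inj k i.+2.
  by have := inj k i.+3; have := inj k N; lia.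
have lt_j1N : j.+1 < N.-1 by have := inj i0.+1 i0; lia.
(* If [i0.+2 < j], the value there is above [j.+1], giving a 312 at [i0], [i0.+1], [i0.+2], or below
   [j], giving one at [i0], [i0.+2], [j.+1]. *)
have ij : i0.+2 = j.
  case: (eqVneq i0.+1 j) => [e|ne1]; first by move: fi1; rewrite e fj; lia.
  case: (eqVneq i0.+2 j) => // ne2.
  have := av i0 i0.+1 i0.+2; have := av i0 i0.+2 j.+1.
  rewrite /bad312 fi0 fi1 fj1; have := fle i0.+2.
  have := inj i0.+2 j; have := inj i0.+2 j.+1.
  by have := inj i0.+2 i0.+1; have := inj i0.+2 i0; lia.
have gN2 : g N.-2 = i0.+1.
  apply: inj; rewrite fg fi1 (_ : N.-2.+1 = N.-1) ?gN1; last by lia.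
  have [] := pmaxg N.-2; [lia|lia|case=> k lt_k gk].
  have kN : k = N.-1 by lia.
  by move: gk; rewrite kN gN1; lia.
(* The same argument one value lower: [N.-2] must stand before [N.-1], and [N.-2], [i0.+1], [j.+1]
   at positions [i1], [i1.+1], [i0.+1] is a 312. *)
have [i1 lt_i1 fi1'] : exists2 i, i < N.+1 & f i = N.-2.
  by apply: (nat_perm_surj fP); lia.
have fi2 : f i1.+1 = i0.+1.
  have := gf i1; rewrite fi1' gN2; have := leq_pmax f (leqnn i1); lia.
have lt_i10 : i1 < i0.
  have := av j j.+1 i1; rewrite /bad312 fj fj1 fi1'.
  have : i1 <> i0 by move=> e; move: fi1'; rewrite e fi0; lia.
  have : i1 <> j by move=> e; move: fi1'; rewrite e fj; lia.
  have : i1 <> j.+1 by move=> e; move: fi1'; rewrite e fj1; lia.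
  have : i1 <> i0.+1 by move=> e; move: fi2; rewrite e ij fj; lia.
  by lia.
have : i1.+1 <> i0 by move=> e; move: fi2; rewrite e fi0; lia.
have : i1.+1 <> i0.+1 by move=> e; move: fi2; rewrite e fi1; lia.
have : N.-2 <> j.+1.
  by move=> e; have := inj i1 i0.+1; lia.
by have := av i1 i1.+1 i0.+1; rewrite /bad312 fi1' fi2 fi1; lia.
Qed.

(** * Transfer between ['S_n] and [nat], and the relation satisfied by [theta] *)

Lemma theta_rel_unique n f f' g :
  nat_perm n f -> nat_perm n f' -> nat_perm n g ->
  theta_rel f g -> theta_rel f' g -> f =1 f'.
Proof.
move=> [_ fid] [_ fid'] gP fg fg' i; case: (ltnP i n) => [|le_ni].
  by case/(nat_perm_surj gP) => j _ <-; rewrite fg fg'.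
by rewrite fid ?fid'.
Qed.

Section Ext.
Variable n : nat.
Implicit Type s t : 'S_n.

Definition ext s (i : nat) : nat :=
  oapp (fun x : 'I_n => val (s x)) i (insub i).

Lemma ext_ord s (x : 'I_n) : ext s x = s x.
Proof. by rewrite /ext valK. Qed.

Lemma ext_geq s i : n <= i -> ext s i = i.
Proof. by move=> le_ni; rewrite /ext insubF // ltnNge le_ni. Qed.

Lemma nat_perm_ext s : nat_perm n (ext s).
Proof.
split=> [i j|i]; last exact: ext_geq.
case: (ltnP i n) => lt_i; case: (ltnP j n) => lt_j.
- rewrite -[i]/(val (Ordinal lt_i)) -[j]/(val (Ordinal lt_j)) !ext_ord.
  by move/val_inj/perm_inj => ->.
- rewrite -[i]/(val (Ordinal lt_i)) ext_ord ext_geq // => e.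
  by have := ltn_ord (s (Ordinal lt_i)); lia.
- rewrite -[j]/(val (Ordinal lt_j)) ext_ord ext_geq // => e.
  by have := ltn_ord (s (Ordinal lt_j)); lia.
- by rewrite !ext_geq.
Qed.

Lemma ext_inj s t : ext s =1 ext t -> s = t.
Proof. by move=> st; apply/permP => x; apply: val_inj; rewrite /= -!ext_ord st. Qed.

Lemma nat_perm_exists f : nat_perm n f -> exists s, ext s =1 f.
Proof.
move=> fP; have h_inj : injective (fun x : 'I_n => Ordinal (nat_perm_ltn fP (ltn_ord x))).
  by move=> x y /(congr1 val)/= /(nat_perm_eq fP)/val_inj.
exists (perm h_inj) => i; case: (ltnP i n) => [lt_i|le_i]; last first.
  by rewrite ext_geq //; case: (fP) => _ ->.
by rewrite -[i in LHS]/(val (Ordinal lt_i)) ext_ord permE.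
Qed.

Lemma one_lineE s : one_line s = map succn (mkseq (ext s) n).
Proof.
rewrite /one_line /mkseq -val_enum_ord -!map_comp.
by apply: eq_map => x /=; rewrite ext_ord.
Qed.

End Ext.

(* [x :: w] is the rest of a word of [theta f] whose letters up to [x] have maximum [m]. *)
Fixpoint theta_from (f : nat -> nat) (m x : nat) (w : seq nat) : Prop :=
  if w is y :: w' then f x = minn y m /\ theta_from f (maxn m y) y w'
  else f x = m.

(** Inside a cycle with maximum [m] the next letter is at most [m], so the minimum is that letter.
    The last letter of the cycle maps to [m], and the next leader, being larger, leaves the minimum
    at [m]. *)
Lemma theta_from_cycle f m x l w : (forall j, iter j f x <= m) ->
    iter l.+1 f x = m ->
    (if w is y :: w' then m < y /\ theta_from f y y w' else True) ->
  theta_from f m x (traject f (f x) l ++ w).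
Proof.
elim: l x => [|l IHl] x le_m /= fx_m w_ok.
  case: w w_ok => [//|y w] /= [lt_my w_ok].
  by rewrite fx_m; split; [lia|rewrite (_ : maxn m y = y) //; lia].
have le_fx := le_m 1; rewrite /= in le_fx.
split; first by lia.
rewrite (_ : maxn m (f x) = m); last by lia.
apply: IHl => //; last by rewrite -iterS iterSr in fx_m.
by move=> j; rewrite -iterSr.
Qed.

Definition theta_of (f : nat -> nat) (w : seq nat) : Prop :=
  if w is y :: w' then theta_from f y y w' else True.

Lemma theta_of_flatten (T : eqType) (v len : T -> nat) f (ms : seq T) :
    sorted (relpre v ltn) ms ->
    {in ms, forall m, 0 < len m} ->
    {in ms, forall m, iter (len m) f (v m) = v m} ->
    {in ms, forall m j, iter j f (v m) <= v m} ->
  theta_of f (flatten [seq traject f (v m) (len m) | m <- ms]).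
Proof.
rewrite /theta_of; elim: ms => //= m ms IHms sorted_ms len_gt0 len_iter le_v.
have in_ms m' : m' \in ms -> m' \in m :: ms by rewrite inE orbC => ->.
have m_in : m \in m :: ms by rewrite inE eqxx.
have := len_gt0 m m_in; have := len_iter m m_in.
case: (len m) => // l fm _ /=; apply: theta_from_cycle => //; first exact: le_v.
have := IHms (path_sorted sorted_ms) (fun m' h => len_gt0 m' (in_ms m' h))
  (fun m' h => len_iter m' (in_ms m' h)) (fun m' h => le_v m' (in_ms m' h)).
case: ms sorted_ms len_gt0 {IHms len_iter le_v in_ms m_in} => //= m' ms.
case/andP => lt_m _ /(_ m'); rewrite !inE eqxx orbT => /(_ isT).
by case: (len m').
Qed.

(** Here [k] is the position of [x] in [g]. The last hypothesis treats the letter after the end of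
    the word like the leader of a new cycle. *)
Lemma theta_from_nth f g w x m k :
    theta_from f m x w -> m = pmax g k ->
    (forall i, i <= size w -> g (k + i) = nth 0 (x :: w) i) ->
    pmax g (k + size w) <= g (k + size w).+1 ->
  forall i, i <= size w -> f (g (k + i)) = minn (g (k + i).+1) (pmax g (k + i)).
Proof.
elim: w x m k => [|y w IHw] x m k /= fw m_eq gw last_le i.
  rewrite leqn0 => /eqP->; rewrite addn0 in last_le *.
  by have := gw 0; rewrite addn0 /= => ->; rewrite // fw; lia.
case: fw => fx fw; case: i => [_|i le_i].
  have := gw 0 isT; have := gw 1 isT; rewrite addn0 addn1 /= => -> ->.
  by rewrite fx m_eq.
rewrite addnS -addSn; apply: (IHw y (maxn m y)) => //.
- by rewrite m_eq /=; congr maxn; rewrite -addn1 gw.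
- by move=> j le_j; rewrite addSn -addnS gw.
- by rewrite addSn -addnS.
Qed.

Section Theta.
Variable n : nat.
Implicit Type s t : 'S_n.

Lemma ext_theta s i : ext (theta s) i = nth i (map val (theta_word s)) i.
Proof.
case: (ltnP i n) => [lt_i|le_i]; last first.
  by rewrite ext_geq // nth_default // size_map size_theta_word.
rewrite -[i in LHS]/(val (Ordinal lt_i)) ext_ord permE.
by rewrite (nth_map (Ordinal lt_i)) ?size_theta_word.
Qed.

Lemma iter_ext s (x : 'I_n) j : iter j (ext s) x = iter j s x.
Proof. by elim: j => //= j ->; rewrite ext_ord. Qed.

Lemma traject_ext s (x : 'I_n) l : map val (traject s x l) = traject (ext s) x l.
Proof. by elim: l x => //= l IHl x; rewrite IHl ext_ord. Qed.

Lemma theta_rel_theta s : theta_rel (ext s) (ext (theta s)).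
Proof.
move=> i; case: (ltnP i n) => [lt_i|]; last exact/theta_rel_geq/nat_perm_ext/nat_perm_ext.
have from : theta_of (ext s) (map val (theta_word s)).
  rewrite /theta_word /std_cycles map_flatten -map_comp.
  under eq_map do rewrite /= traject_ext.
  apply: (@theta_of_flatten _ (@nat_of_ord n) (fun m => #|porbit s m|)).
  - apply: sorted_filter; first by move=> x y z /=; apply: ltn_trans.
    by rewrite -sorted_map val_enum_ord iota_ltn_sorted.
  - by move=> m _; apply/card_gt0P; exists m; apply: porbit_id.
  - by move=> m _; rewrite iter_ext iter_porbit.
  - move=> m; rewrite mem_filter => /andP[/forall_inP max_m _] j.
    by rewrite iter_ext -permX; apply/max_m/mem_porbit.
have szw : size (map val (theta_word s)) = n by rewrite size_map size_theta_word.
have gw j : ext (theta s) j = nth j (map val (theta_word s)) j by exact: ext_theta.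
case: (map val _) => [|y w] in from szw gw; first by move: szw => /= n0; lia.
have gP := nat_perm_ext (theta s).
have /(_ (ext (theta s)) 0) := theta_from_nth from; apply.
- by rewrite /= gw.
- by move=> j le_j; rewrite gw; apply: set_nth_default.
- rewrite add0n [X in _ <= X]ext_geq; last by move: szw => /=; lia.
  apply: ltnW; apply: leq_trans (_ : n <= _); last by move: szw => /=; lia.
  by apply: (pmax_ltn gP); move: szw => /=; lia.
- by move: szw => /=; lia.
Qed.

(** The relation determines [s] from [t], so [theta] is injective, hence bijective on a finite set;
    the preimage of [t] satisfies the same relation as [s] and equals it. *)
Lemma thetaP s t : reflect (theta_rel (ext s) (ext t)) (theta s == t).
Proof.
apply: (iffP eqP) => [<-|st]; first exact: theta_rel_theta.
have theta_injective : injective (@theta n).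
  move=> s1 s2 e; apply: ext_inj.
  apply: (@theta_rel_unique n _ _ (ext (theta s1))); try exact: nat_perm_ext.
    exact: theta_rel_theta.
  by rewrite e; apply: theta_rel_theta.
have [h _ hK] := injF_bij theta_injective.
rewrite -[t]hK; congr theta; apply: ext_inj.
apply: (@theta_rel_unique n _ _ (ext t)) => //; try exact: nat_perm_ext.
by rewrite -{2}[t]hK; apply: theta_rel_theta.
Qed.

End Theta.

(** * Pattern occurrences as triples of positions *)

Lemma order_iso231 x y z : order_iso [:: x; y; z] [:: 2; 3; 1] = bad231 x y z.
Proof.
rewrite /order_iso /bad231 /=; apply/forallP/andP => [iso|[zx xy] i].
  have /forallP/(_ ord0) := iso (inord 2); have /forallP/(_ (inord 1)) := iso ord0.
  by rewrite !inordK //= => /eqP-> /eqP->.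
apply/forallP => j; case: i j => [[|[|[|i]]] lt_i] [[|[|[|j]]] lt_j] //=; lia.
Qed.

Lemma order_iso312 x y z : order_iso [:: x; y; z] [:: 3; 1; 2] = bad312 x y z.
Proof.
rewrite /order_iso /bad312 /=; apply/forallP/andP => [iso|[yz zx] i].
  have /forallP/(_ (inord 2)) := iso (inord 1); have /forallP/(_ ord0) := iso (inord 2).
  by rewrite !inordK //= => /eqP-> /eqP->.
apply/forallP => j; case: i j => [[|[|[|i]]] lt_i] [[|[|[|j]]] lt_j] //=; lia.
Qed.

Lemma subseq3_mkseqP (T : eqType) (f : nat -> T) n u : size u = 3 ->
  reflect (exists i j k, i < j < k /\ k < n /\ u = [:: f i; f j; f k])
          (subseq u (mkseq f n)).
Proof.
move=> sz_u; apply: (iffP idP) => [/subseqP[m _ u_eq]|[i [j [k [ijk [lt_k ->]]]]]].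
  rewrite /mkseq -map_mask in u_eq.
  have sorted_m : sorted ltn (mask m (iota 0 n)).
    by apply: sorted_mask; [exact: ltn_trans|exact: iota_ltn_sorted].
  have mem_m x : x \in mask m (iota 0 n) -> x < n.
    by move/mem_mask; rewrite mem_iota.
  move: (mask _ _) u_eq sorted_m mem_m => [|i [|j [|k [|l r]]]] u_eq sorted_m mem_m;
    rewrite u_eq // in sz_u.
  exists i, j, k; split; first by move: sorted_m => /=; lia.
  by split=> //; apply: mem_m; rewrite !inE eqxx !orbT.
rewrite -[[:: _; _; _]]/(map f [:: i; j; k]); apply: map_subseq.
suff -> : [:: i; j; k] = [seq x <- iota 0 n | x \in [:: i; j; k]].
  exact: filter_subseq.
apply: (irr_sorted_eq ltn_trans ltnn); first by rewrite /=; lia.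
  by apply: sorted_filter; [exact: ltn_trans|exact: iota_ltn_sorted].
by move=> x; rewrite mem_filter mem_iota !inE; lia.
Qed.

Lemma eq_theta_rel f f' g g' : f =1 f' -> g =1 g' ->
  theta_rel f g -> theta_rel f' g'.
Proof.
move=> ff' gg' fg i; rewrite -ff' -!gg' fg; congr minn.
exact: eq_pmax.
Qed.

(** * Counting by the last block, for both patterns at once *)

Section Counting.
Variables (bad : nat -> nat -> nat -> bool) (sigma b4 : seq nat).
Hypothesis size_sigma : size sigma = 3.
Hypothesis order_iso_bad : forall x y z, order_iso [:: x; y; z] sigma = bad x y z.
Hypothesis bad_gt : forall x y z, bad x y z -> z < x.
Hypothesis bad_add : forall k x y z, bad (k + x) (k + y) (k + z) = bad x y z.

(** The last entry of an occurrence is below the first, so the identity tail adds no occurrence. *)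
Lemma avoidsP n (s : 'S_n) : reflect (avoidf bad (ext s)) (avoids s sigma).
Proof.
have sP := nat_perm_ext s.
apply: (iffP idP) => [av i j k ijk|av].
  apply/negP => bd; case: (ltnP k n) => [lt_k|le_k]; last first.
    have := bad_gt bd; rewrite [ext s k]ext_geq //.
    case: (ltnP i n) => [lt_i|le_i]; last by rewrite ext_geq; lia.
    by have := nat_perm_ltn sP lt_i; lia.
  case/negP: av; apply/containsP; rewrite one_lineE.
  exists (map succn [:: ext s i; ext s j; ext s k]).
    by apply: map_subseq; apply/subseq3_mkseqP => //; exists i, j, k.
  by rewrite order_iso_bad -[_.+1]add1n -[(ext s j).+1]add1n -[(ext s k).+1]add1n bad_add.
apply/negP => /containsP[u sub iso].
have sz_u : size u = 3 by case/andP: iso; rewrite size_sigma => /eqP.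
move: sub; rewrite one_lineE /mkseq -map_comp => /subseq3_mkseqP -/(_ sz_u).
case=> i [j [k [ijk [_ u_eq]]]]; move: iso; rewrite u_eq /= order_iso_bad.
rewrite -[_.+1]add1n -[(ext s j).+1]add1n -[(ext s k).+1]add1n bad_add.
exact/negP/av.
Qed.

(** The first entry of an occurrence exceeds the last, so both, and the middle one, lie in one
    summand. *)
Lemma avoidf_dsum k m f b : nat_perm k f -> nat_perm m b ->
  avoidf bad (dsum k f b) <-> avoidf bad f /\ avoidf bad b.
Proof.
move=> fP bP.
have fid : forall i, k <= i -> f i = i by case: fP.
have high i : k <= i -> dsum k f b i = k + b (i - k) by rewrite /dsum ltnNge => ->.
split=> [av|[avf avb] x y z xyz].
  split=> x y z xyz.
    case: (ltnP z k) => [lt_z|le_z].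
      by have := av x y z xyz; rewrite !dsum_lt //; lia.
    apply/negP => /bad_gt; rewrite [f z]fid //.
    case: (ltnP x k) => [lt_x|le_x]; last by rewrite fid //; lia.
    by have := nat_perm_ltn fP lt_x; lia.
  by have := av (k + x) (k + y) (k + z); rewrite !dsum_add bad_add; apply; lia.
case: (ltnP x k) => [lt_x|le_x].
  case: (ltnP z k) => [lt_z|le_z]; last first.
    apply/negP => /bad_gt; rewrite (dsum_lt _ _ lt_x) (high z le_z).
    by have := nat_perm_ltn fP lt_x; lia.
  by rewrite !dsum_lt //; try lia; apply: avf.
by rewrite !high ?bad_add; try lia; apply: avb; lia.
Qed.

(** The relational form of avoidance together with [theta (theta f) = f]. *)
Definition good n f : Prop :=
  nat_perm n f /\ avoidf bad f /\
  exists2 g, nat_perm n g & theta_rel f g /\ theta_rel g f.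

(** From left to right, the companion [g] has the same stable prefix by [theta_rel_stable], so it
    splits at [k] too. *)
Lemma good_dsum k m f b : nat_perm k f -> nat_perm m b ->
  good (k + m) (dsum k f b) <-> good k f /\ good m b.
Proof.
move=> fP bP; split; last first.
  case=> -[_ [avf [g gP [fg gf]]]] [_ [avb [c cP [bc cb]]]].
  split; first exact: nat_perm_dsum.
  split; first by apply/(avoidf_dsum fP bP).
  exists (dsum k g c); first exact: nat_perm_dsum.
  by split; apply/theta_rel_dsum.
case=> fbP [av [g gP [fg gf]]].
have [avf avb] := (avoidf_dsum fP bP).1 av.
have gk : forall i, i < k -> g i < k.
  apply: (theta_rel_stable fbP gP) fg => [|i lt_i]; first by lia.
  by rewrite dsum_lt ?(nat_perm_ltn fP).
have [|g1 [c [g1P cP g_eq]]] := dsum_split gP _ gk; first by lia.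
rewrite addKn in cP.
have [fg1 bc] := (theta_rel_dsum b c fP g1P).1 (eq_theta_rel (frefl _) g_eq fg).
have [gf1 cb] := (theta_rel_dsum c b g1P fP).1 (eq_theta_rel g_eq (frefl _) gf).
by split; do 2?split=> //; [exists g1|exists c].
Qed.

Lemma eq_good n f f' : f =1 f' -> good n f -> good n f'.
Proof.
move=> ff' [[finj fid] [av [g gP [fg gf]]]]; split; last split.
- by split=> [i j|i /fid]; rewrite -!ff' // => /finj.
- by move=> i j k ijk; rewrite -!ff'; apply: av.
- exists g => //; split; first exact: eq_theta_rel ff' (frefl _) fg.
  exact: eq_theta_rel (frefl _) ff' gf.
Qed.

Hypothesis indec_blocks : forall N f g, nat_perm N.+1 f -> nat_perm N.+1 g ->
  theta_rel f g -> theta_rel g f -> avoidf bad f -> indecomposable N.+1 f ->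
  [\/ mkseq f N.+1 = [:: 0], mkseq f N.+1 = [:: 1; 0] | mkseq f N.+1 = b4].
Hypothesis size_b4 : size b4 = 4.
(** A word of size [n] ending in this block then has last letter at most [n - 3], whereas the blocks
    1 and 21 give [n - 1] and [n - 2]. *)
Hypothesis last_b4 : last 0 b4 < 2.
Hypothesis good_block1 : good 1 (block [:: 0]).
Hypothesis good_block2 : good 2 (block [:: 1; 0]).
Hypothesis good_block4 : good 4 (block b4).

Definition append k (b w : seq nat) : seq nat := w ++ map (addn k) b.

(** The words of the good functions, listed by their last block; the nested matches keep the
    recursion structural. *)
Fixpoint words n : seq (seq nat) :=
  if n is n1.+1 then
    map (append n1 [:: 0]) (words n1) ++
    if n1 is n2.+1 then
      map (append n2 [:: 1; 0]) (words n2) ++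
      if n2 is n3.+1 then
        if n3 is n4.+1 then map (append n4 b4) (words n4) else [::]
      else [::]
    else [::]
  else [:: [::]].

Lemma mkseq_dsum k m f b :
  mkseq (dsum k f b) (k + m) = append k (mkseq b m) (mkseq f k).
Proof.
rewrite /append /mkseq iotaD map_cat add0n; congr cat.
  by apply/eq_in_map => i; rewrite mem_iota => lt_i; rewrite dsum_lt.
rewrite -map_comp -[k in iota k]addn0 iotaDl -map_comp.
by apply: eq_map => i /=; rewrite dsum_add.
Qed.

Lemma mkseq_block b : mkseq (block b) (size b) = b.
Proof.
apply: (@eq_from_nth _ 0); rewrite size_mkseq // => i lt_i.
by rewrite nth_mkseq //; apply: set_nth_default.
Qed.

Lemma mem_wordsP n w : reflect
  (n = 0 /\ w = [::] \/ exists k b u,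
     [/\ n = k + size b, b \in [:: [:: 0]; [:: 1; 0]; b4],
         u \in words k & w = append k b u]) (w \in words n).
Proof.
apply: (iffP idP).
  case: n => [|n1] /=; first by rewrite inE => /eqP->; left.
  move=> w_in; right; move: w_in; rewrite mem_cat => /orP[/mapP[u u_in ->]|].
    by exists n1, [:: 0], u; rewrite addn1 !inE eqxx.
  case: n1 => [|n2] //; rewrite mem_cat => /orP[/mapP[u u_in ->]|].
    by exists n2, [:: 1; 0], u; rewrite addn2 !inE eqxx orbT.
  case: n2 => [|[|n4]] // /mapP[u u_in ->].
  by exists n4, b4, u; rewrite size_b4 !addnS addn0 !inE eqxx !orbT.
case=> [[-> ->] //|[k [b [u [-> b_in u_in ->]]]]].
move: b_in; rewrite !inE => /or3P[] /eqP->; rewrite ?size_b4 /= !addnS addn0.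
- by rewrite /= mem_cat map_f.
- by rewrite /= !mem_cat map_f ?orbT.
- by rewrite /= !mem_cat (map_f _ u_in) !orbT.
Qed.

Lemma words_good n w : w \in words n -> exists2 f, good n f & w = mkseq f n.
Proof.
elim/ltn_ind: n w => n IHn w /mem_wordsP[[-> ->]|[k [b [u [n_eq b_in u_in ->]]]]].
  have id_perm : nat_perm 0 id by split.
  exists id => //; split=> //; split.
    by move=> i j k ijk; apply/negP => /bad_gt; lia.
  by exists id => //; split=> i; apply: (theta_rel_geq id_perm id_perm).
have gb : good (size b) (block b).
  by move: b_in; rewrite !inE => /or3P[] /eqP->; rewrite ?size_b4.
have b_gt0 : 0 < size b.
  by move: b_in; rewrite !inE => /or3P[] /eqP->; rewrite ?size_b4.
have [|f gf ->] := IHn k _ u u_in; first by lia.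
exists (dsum k f (block b)); rewrite n_eq; last by rewrite mkseq_dsum mkseq_block.
by apply/good_dsum => //; [case: gf|case: gb].
Qed.

Lemma good_words n f : good n f -> mkseq f n \in words n.
Proof.
elim/ltn_ind: n f => -[|n] IHn f fgood //.
pose stable k := (k < n.+1) && all (fun i => f i < k) (iota 0 k).
have stableP k : k < n.+1 -> (forall i, i < k -> f i < k) -> stable k.
  by move=> lt_k fk; apply/andP; split=> //; apply/allP => i; rewrite mem_iota => /fk.
have ex_stable : exists k, stable k by exists 0.
have stable_le k : stable k -> k <= n by case/andP.
(* Cutting at the largest proper stable prefix, possibly empty, makes the remaining summand
   indecomposable, hence one of the three blocks. *)
case: (ex_maxnP ex_stable stable_le) => k /andP[lt_k /allP fk] max_k.
have {}fk i : i < k -> f i < k by move=> lt_i; apply: fk; rewrite mem_iota.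
have [fP _] := fgood.
have [f1 [b [f1P bP f_eq]]] := dsum_split fP (ltnW lt_k) fk.
have n_eq : n.+1 = k + (n - k).+1 by lia.
rewrite (_ : n.+1 - k = (n - k).+1) in bP; last by lia.
have := eq_good f_eq fgood; rewrite {1}n_eq => /(good_dsum f1P bP)[g1 gb].
have ind : indecomposable (n - k).+1 b.
  move=> j lt_j bj; have := max_k (k + j); rewrite stableP; try by lia.
  move=> i lt_i; rewrite f_eq /dsum; case: (ltnP i k) => [lt_ik|le_ki].
    by have := nat_perm_ltn f1P lt_ik; lia.
  by have := bj (i - k); lia.
have [_ [avb [c cP [bc cb]]]] := gb.
have blk := indec_blocks bP cP bc cb avb ind.
apply/mem_wordsP; right; exists k, (mkseq b (n - k).+1), (mkseq f1 k); split.
- by rewrite size_mkseq.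
- by case: blk => ->; rewrite !inE eqxx ?orbT.
- by apply: IHn.
- by rewrite n_eq -mkseq_dsum; apply: eq_map.
Qed.

Lemma append_inj k b : injective (append k b).
Proof.
move=> u v; rewrite /append => e; have /(congr1 size) := e.
rewrite !size_cat => /addIn sz_uv.
by move/eqP: e; rewrite eqseq_cat // => /andP[/eqP].
Qed.

Lemma last_append k b u : 0 < size b -> last 0 (append k b u) = k + last 0 b.
Proof. by case: b => // x b _; rewrite last_cat /= last_map. Qed.

(* The last letter tells which block was appended last. *)
Lemma words_uniq n : uniq (words n).
Proof.
elim/ltn_ind: n => -[|n1] IHn //=.
rewrite cat_uniq (map_inj_uniq (@append_inj _ _)) IHn //=; apply/andP; split.
  apply/hasPn => w w_in; apply/negP => /mapP[u _ w_eq].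
  have last_w : last 0 w = n1 by rewrite w_eq last_append //= addn0.
  case: n1 => // n2 in IHn w_in w_eq last_w *.
  move: w_in; rewrite mem_cat => /orP[/mapP[v _ e]|].
    by move: last_w; rewrite e last_append //=; lia.
  case: n2 => [|[|n4]] // in IHn w_eq last_w * => /mapP[v _ e].
  by move: last_w; rewrite e last_append ?size_b4 //; lia.
case: n1 => // n2 in IHn *.
rewrite cat_uniq (map_inj_uniq (@append_inj _ _)) IHn //=; apply/andP; split.
  apply/hasPn => w w_in; apply/negP => /mapP[u _ w_eq].
  have last_w : last 0 w = n2 by rewrite w_eq last_append //= addn0.
  case: n2 => [|[|n4]] // in IHn w_in w_eq last_w *.
  case/mapP: w_in => v _ e.
  by move: last_w; rewrite e last_append ?size_b4 //; lia.
case: n2 => [|[|n4]] // in IHn *.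
by rewrite (map_inj_uniq (@append_inj _ _)) IHn //; lia.
Qed.

Lemma f2E n : f2 n sigma = size (words n).
Proof.
rewrite /f2 cardE -(size_map (fun s : 'S_n => mkseq (ext s) n)).
apply: perm_size; apply: uniq_perm; last 1 first.
- move=> w; apply/mapP/idP => [[s]|w_in].
    rewrite mem_enum inE => /andP[/avoidsP av fix_s] ->; apply: good_words.
    split; first exact: nat_perm_ext.
    split=> //; exists (ext (theta s)); first exact: nat_perm_ext.
    by split; [exact: theta_rel_theta|apply/thetaP].
  have [f fgood ->] := words_good w_in.
  have [fP _] := fgood; have [s s_eq] := nat_perm_exists fP.
  have [_ [av [g gP [fg gf]]]] := eq_good (fsym s_eq) fgood.
  have [t t_eq] := nat_perm_exists gP.
  exists s; last by apply: eq_map => i; rewrite s_eq.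
  rewrite mem_enum inE; apply/andP; split; first exact/avoidsP.
  have /thetaP/eqP -> := eq_theta_rel (frefl (ext s)) (fsym t_eq) fg.
  exact/thetaP/(eq_theta_rel (fsym t_eq) (frefl (ext s)) gf).
- rewrite map_inj_uniq ?enum_uniq // => s t st; apply: ext_inj => i.
  case: (ltnP i n) => [lt_i|le_i]; last by rewrite !ext_geq.
  by have := congr1 (nth 0 ^~ i) st; rewrite !nth_mkseq.
- exact: words_uniq.
Qed.

Lemma f2_rec :
  [/\ f2 0 sigma = 1, f2 1 sigma = 1, f2 2 sigma = 2 & f2 3 sigma = 3] /\
  forall n, f2 n.+4 sigma = f2 n.+3 sigma + f2 n.+2 sigma + f2 n sigma.
Proof.
split=> [|n]; first by rewrite !f2E.
have -> : f2 n.+4 sigma = size (map (append n.+3 [:: 0]) (words n.+3) ++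
    map (append n.+2 [:: 1; 0]) (words n.+2) ++ map (append n b4) (words n)).
  by rewrite f2E.
by rewrite !size_cat !size_map !f2E addnA.
Qed.

End Counting.

(** * Verification of the blocks and the recurrence *)

(** Reduces goodness of a concrete block to finite checks that compute; [c] is its image under
    [theta]. *)
Lemma good_blockP (bad : nat -> nat -> nat -> bool) (b c : seq nat) : let n := size b in
    size c = n -> perm_eq b (iota 0 n) -> perm_eq c (iota 0 n) ->
    (forall x y z, bad x y z -> z < x) ->
    all (fun i => all (fun j => all (fun k =>
      (i < j < k) ==> ~~ bad (block b i) (block b j) (block b k))
      (iota 0 n)) (iota 0 n)) (iota 0 n) ->
    all (fun i => block b (block c i) == minn (block c i.+1) (pmax (block c) i))
      (iota 0 n) ->
    all (fun i => block c (block b i) == minn (block b i.+1) (pmax (block b) i))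
      (iota 0 n) ->
  good bad n (block b).
Proof.
move=> n sz_c perm_b perm_c bad_gt av bc cb.
have blockP s : size s = n -> perm_eq s (iota 0 n) -> nat_perm n (block s).
  move=> sz_s perm_s.
  have id_geq i : n <= i -> block s i = i.
    by move=> le_i; rewrite /block nth_default ?sz_s.
  have lt_n i : i < n -> block s i < n.
    move=> lt_i; have : block s i \in s by rewrite mem_nth ?sz_s.
    by rewrite (perm_mem perm_s) mem_iota.
  split=> // i j; have := lt_n i; have := lt_n j.
  case: (ltnP i n) => lt_i; case: (ltnP j n) => lt_j; rewrite ?(id_geq _ lt_i) ?(id_geq _ lt_j); try lia.
  move=> _ _; rewrite /block (set_nth_default i) ?sz_s // => /eqP.
  rewrite nth_uniq ?sz_s //; first by move/eqP.
  by rewrite (perm_uniq perm_s) iota_uniq.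
have bP := blockP b erefl perm_b; have cP := blockP c sz_c perm_c.
have rel f g : nat_perm n f -> nat_perm n g ->
    all (fun i => f (g i) == minn (g i.+1) (pmax g i)) (iota 0 n) -> theta_rel f g.
  move=> fP gP /allP fg i; case: (ltnP i n) => [lt_i|]; last exact: theta_rel_geq.
  by apply/eqP/fg; rewrite mem_iota.
split=> //; split; last by exists (block c) => //; split; apply: rel.
move=> i j k ijk; case: (ltnP k n) => [lt_k|le_k].
  have in_n x : x < n -> x \in iota 0 n by rewrite mem_iota.
  have [lt_i lt_j] : i < n /\ j < n by lia.
  move/allP/(_ i (in_n i lt_i))/allP/(_ j (in_n j lt_j)): av.
  by move/allP/(_ k (in_n k lt_k)); rewrite ijk.
apply/negP => /bad_gt; have [_ id_geq] := bP; rewrite [block b k]id_geq //.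
case: (ltnP i n) => [lt_i|/id_geq->]; last by lia.
by have := nat_perm_ltn bP lt_i; lia.
Qed.

Lemma f2_recurrence sigma : sigma = [:: 2; 3; 1] \/ sigma = [:: 3; 1; 2] ->
  [/\ f2 0 sigma = 1, f2 1 sigma = 1, f2 2 sigma = 2 & f2 3 sigma = 3] /\
  forall n, f2 n.+4 sigma = f2 n.+3 sigma + f2 n.+2 sigma + f2 n sigma.
Proof.
have gt231 x y z : bad231 x y z -> z < x by rewrite /bad231; lia.
have gt312 x y z : bad312 x y z -> z < x by rewrite /bad312; lia.
have add231 k x y z : bad231 (k + x) (k + y) (k + z) = bad231 x y z.
  by rewrite /bad231 !ltn_add2l.
have add312 k x y z : bad312 (k + x) (k + y) (k + z) = bad312 x y z.
  by rewrite /bad312 !ltn_add2l.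
case=> ->.
- apply: (f2_rec _ order_iso231 gt231 add231 indecomposable231) => //.
  + exact: (@good_blockP _ [:: 0] [:: 0]).
  + exact: (@good_blockP _ [:: 1; 0] [:: 1; 0]).
  + exact: (@good_blockP _ [:: 3; 0; 2; 1] [:: 2; 3; 1; 0]).
- apply: (f2_rec _ order_iso312 gt312 add312 indecomposable312) => //.
  + exact: (@good_blockP _ [:: 0] [:: 0]).
  + exact: (@good_blockP _ [:: 1; 0] [:: 1; 0]).
  + exact: (@good_blockP _ [:: 2; 3; 1; 0] [:: 3; 0; 2; 1]).
Qed.

(** * The generating function *)

Import GRing.Theory.
Local Open Scope ring_scope.

Theorem theorem5p2 (sigma : seq nat)
    (hsigma : sigma = [:: 2; 3; 1]%N \/ sigma = [:: 3; 1; 2]%N) :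
  (fun n => (f2 n sigma)%:R : int) =1
  fps_div (fps_one int)
    (fps_of_poly (1 - 'X - 'X^2 - 'X^4 : {poly int})).
Proof.
have [[f0 f1 f2' f3] rec] := f2_recurrence hsigma.
set p : {poly int} := 1 - 'X - 'X^2 - 'X^4.
have pE k : p`_k = (k == 0%N)%:R - (k == 1%N)%:R - (k == 2)%:R - (k == 4)%:R.
  by rewrite /p !coefB coef1 coefX !coefXn.
have div1 n : fps_div (fps_one int) (fps_of_poly p) n = fps_inv (fps_of_poly p) n.
  rewrite /fps_div /fps_mul big_ord_recl mul1r subn0 big1 ?addr0 // => i _.
  by rewrite mul0r.
(* By uniqueness of inverses it suffices that [p] times the series is 1: degrees 0 to 3 use the
   initial values, higher ones the recurrence. *)
move=> n; rewrite div1; apply: (@fps_inv_uniq _ _ (fun n => (f2 n sigma)%:R)) => {n}.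
  by rewrite /fps_of_poly pE.
move=> n; rewrite /fps_mul /fps_of_poly /fps_one.
case: n => [|[|[|[|n]]]]; rewrite !big_ord_recl ?big_ord0 /= !pE /=.
- by rewrite f0.
- by rewrite f1 f0.
- by rewrite f2' f1 f0.
- by rewrite f3 f2' f1 f0.
(* Five terms have been split off; the coefficients of [p] from degree 5 on vanish. *)
rewrite big1 => [|i _]; last by rewrite pE /= mul0r.
rewrite !subSS !subn0 rec !natrD /=; ring.
Qed.
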